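(* Let $n\ge1$ be an integer, and let a society consist of $n$ egoists, the utility increments in a random proposal being independent random variables with the Laplace distribution with parameters $\mu\in\mathbb{R}$ and $\lambda>0$. Let $\rho=\mu/\sigma$, where $\sigma$ is the standard deviation of this distribution. Then $$\alpha_0=\frac12\left(1+\mathrm{sign}(\rho)\,\frac{1-\sqrt2|\rho|-\exp\left(-\sqrt2|\rho|\right)}{1+\sqrt2|\rho|}\right)$$ is an optimal majority/acceptance threshold, i.e. $\mathrm{E}(\eta_i(\alpha_0))\ge \mathrm{E}(\eta_i(\alpha))$ for every $\alpha\in[-\frac1n,1]$ and every $i\in\{1,\dots,n\}$.
   Context: The Laplace distribution with location parameter $\mu$ and rate parameter $\lambda>0$ has density $f(x)=\frac{\lambda}{2}\exp(-\lambda|x-\mu|)$, $x\in\mathbb{R}$; its standard deviation is $\sigma=\sqrt2/\lambda$. $\mathrm{sign}(\rho)$ is $1,0,-1$ for $\rho>0$, $\rho=0$, $\rho<0$ respectively. Setting (ViSE model, society of $n$ egoists): a random proposal is a vector $\boldsymbol\zeta=(\zeta_1,\ldots,\zeta_n)$ of independent identically distributed real random variables; $\zeta_i$ is the proposed utility increment of agent $i$. Each agent votes for the proposal if and only if his/her own proposed increment is positive. For a relative voting threshold $\alpha\in[-\frac1n,1]$, the proposal is accepted if and only if $\#\{k:\zeta_k>0,\ k=1,\ldots,n\}>\alpha n$. The actual utility increments are $\eta_i(\alpha)=\zeta_i\, I(\boldsymbol\zeta,\alpha n)$, where $I(\boldsymbol\zeta,\alpha n)=1$ if $\#\{k:\zeta_k>0\}>\alpha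 n$ and $I(\boldsymbol\zeta,\alpha n)=0$ otherwise. A threshold in $[-\frac1n,1]$ is called optimal if it provides the highest possible expected utility increment $\mathrm{E}(\eta_i(\alpha))$ of an agent (this expectation does not depend on $i$); optimal thresholds are not unique. *)

(* Defs.v *)
(* MathComp-Analysis, over an arbitrary [R : realType]. *)
From mathcomp Require Import all_boot all_order all_algebra.
From mathcomp Require Import all_classical all_reals all_analysis.
Set Implicit Arguments.
Unset Strict Implicit.
Unset Printing Implicit Defensive.
Import Order.TTheory GRing.Theory Num.Theory.

Local Open Scope classical_set_scope.
Local Open Scope ring_scope.

Definition laplace_pdf (R : realType) (mu lambda x : R) : R :=
  lambda / 2 * expR (- lambda * `|x - mu|).

Definition laplace_prob (R : realType) (mu lambda : R) (A : set R) : \bar R :=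
  (\int[lebesgue_measure]_(x in A) (laplace_pdf mu lambda x)%:E)%E.

Definition laplace_distributed (d : measure_display) (T : measurableType d)
    (R : realType) (P : probability T R) (mu lambda : R) (X : {RV P >-> R}) :
    Prop :=
  forall A : set R, measurable A ->
    distribution P X A = laplace_prob mu lambda A.

(* Mutual independence of a finite family: the product rule for every
   subfamily [J] and every choice of Borel sets. *)
Definition mutually_independent (d : measure_display) (T : measurableType d)
    (R : realType) (P : probability T R) (n : nat)
    (X : 'I_n -> {RV P >-> R}) : Prop :=
  forall (J : {set 'I_n}) (A : 'I_n -> set R),
    (forall j, measurable (A j)) ->
    P [set w | forall j, j \in J -> A j (X j w)] =
    (\prod_(j in J) P (X j @^-1` A j))%E.

(* [fine] sends infinite values to 0; this is harmless for square-integrable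
   [X], in particular for Laplace random variables. *)
Definition std_dev (d : measure_display) (T : measurableType d)
    (R : realType) (P : probability T R) (X : T -> R) : R :=
  Num.sqrt (fine ('V_P[X])%E).

Section Voting.
Variables (T : Type) (R : realType) (n : nat) (zeta : 'I_n -> T -> R).

(* Agent [k] votes for the proposal iff his own increment is positive. *)
Definition votes_for (w : T) : nat := #|[set k | (0 < zeta k w)%R]%SET|.

Definition accepted (alpha : R) (w : T) : bool :=
  alpha * n%:R < (votes_for w)%:R.

Definition actual_increment (alpha : R) (i : 'I_n) (w : T) : R :=
  zeta i w * (accepted alpha w)%:R.

End Voting.

(* [alpha] is a relative threshold: the vote count has to exceed
   [alpha * n]; at [alpha = -1/n] every proposal is accepted. *)
Definition admissible_threshold (R : realType) (n : nat) (alpha : R) : Prop :=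
  - (n%:R)^-1 <= alpha <= 1.

Definition optimal_threshold (d : measure_display) (T : measurableType d)
    (R : realType) (P : probability T R) (n : nat)
    (zeta : 'I_n -> {RV P >-> R}) (alpha : R) : Prop :=
  admissible_threshold n alpha /\
  forall beta : R, admissible_threshold n beta ->
  forall i : 'I_n,
    ('E_P[actual_increment zeta beta i] <= 'E_P[actual_increment zeta alpha i])%E.

Definition laplace_threshold (R : realType) (rho : R) : R :=
  let s := Num.sqrt 2 * `|rho| in
  2^-1 * (1 + Num.sg rho * ((1 - s - expR (- s)) / (1 + s))).

(* Main.v *)
From HB Require Import structures.
Require Import Defs.
From mathcomp Require Import all_boot all_order all_algebra perm.
From mathcomp Require Import all_classical all_reals all_analysis.
From mathcomp Require Import measurable_realfun ring lra.
Import Order.TTheory GRing.Theory Num.Theory.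
Import numFieldNormedType.Exports.
Local Open Scope ring_scope.
Set Implicit Arguments.
Unset Strict Implicit.
Unset Printing Implicit Defensive.

(** Write p and q for the probabilities that an increment is positive,
    respectively nonpositive, and m and m' for the expectations of its positive
    and negative parts.  Expected gains are computed profile by profile, a
    profile being the set A of agents who vote for the proposal.  By
    independence, on a profile with k supporters a supporter gains
    m p^(k-1) q^(n-k) in expectation and an opponent gains
    - m' p^k q^(n-k-1) ([expectation_profile]).

    A threshold only sees the number of supporters, so the expected increment is
    the same for all agents and equals the average over the agents: every
    accepted profile contributes its total gain, divided by n
    ([sum_subsets_average]).  The total gain of a profile with k supporters has
    the sign of k m q - (n - k) m' p, that is, of k - b n with
    b = m' p / (m q + m' p) ([total_gainE]).  Accepting exactly the profiles with
    k > b n therefore keeps all the positive totals and none of the negative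
    ones, so b is optimal ([balance_point_optimal]).

    It remains to evaluate b.  Beyond the location parameter the Laplace density
    is a multiple of an exponential density, so the probability of a tail and the
    first two moments of the excess over a point of the tail are explicit
    ([integral_laplace_tail]); the other tail follows by the reflection
    X |-> - X.  These give the mean mu and the standard deviation
    sqrt 2 / lambda, hence sqrt 2 |rho| = lambda |mu|.  Zero lies in the lower
    tail when mu >= 0 and in the upper one when mu < 0; there the tail formulas
    give one of p, q and one of m, m', and the other two follow from p + q = 1
    and m - m' = mu. *)

(** * Integration against a density *)

Section density.
Local Open Scope classical_set_scope.

(** The density agrees almost everywhere with the Radon-Nikodym derivative, for
    which the change of variables is known. *)
Lemma ge0_integral_density d (T : measurableType d) (R : realType)
    (mu : {sigma_finite_measure set T -> \bar R})
    (nu : {finite_measure set T -> \bar R}) (g : T -> \bar R) (f : T -> \bar R) :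
    measurable_fun setT g -> (forall x, 0 <= g x)%E ->
    (forall A, measurable A -> nu A = \int[mu]_(x in A) g x)%E ->
    measurable_fun setT f -> (forall x, 0 <= f x)%E ->
  (\int[nu]_x f x = \int[mu]_x (f x * g x))%E.
Proof.
move=> mg g0 nug mf f0.
have numu : nu `<< mu.
  apply/null_content_dominatesP => A mA muA.
  by rewrite nug// null_set_integral//; exact: measurable_funTS.
rewrite -(Radon_Nikodym_SigmaFinite.change_of_variables numu)//.
apply: ae_eq_integral => //.
- apply: emeasurable_funM => //.
  exact: measurable_int (Radon_Nikodym_SigmaFinite.f_integrable numu).
- exact: emeasurable_funM.
- apply: ae_eqe_mul2l; apply: integral_ae_eq => //.
    exact: Radon_Nikodym_SigmaFinite.f_integrable.
  by move=> E _ mE; rewrite -Radon_Nikodym_SigmaFinite.f_integral// nug.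
Qed.

End density.

(** * Tails of the Laplace law *)

Section laplace_density.
Local Open Scope classical_set_scope.
Context {R : realType}.
Variables (mu lambda : R).
Hypothesis lambda_gt0 : 0 < lambda.
Local Notation leb := (@lebesgue_measure R).

Lemma laplace_pdf_ge0 x : 0 <= laplace_pdf mu lambda x.
Proof. by rewrite /laplace_pdf mulr_ge0 ?expR_ge0// divr_ge0// ltW. Qed.

Lemma continuous_laplace_pdf : continuous (laplace_pdf mu lambda).
Proof.
move=> x; apply: cvgM; first exact: cvg_cst.
apply: continuous_comp; last exact: continuous_expR.
apply: cvgM; first exact: cvg_cst.
apply: (@cvg_norm _ R^o).
by apply: (@cvgB _ R^o); [exact: cvg_id|exact: cvg_cst].
Qed.

Lemma measurable_laplace_pdf : measurable_fun setT (laplace_pdf mu lambda).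
Proof. exact: continuous_measurable_fun continuous_laplace_pdf. Qed.

(** The cubic lower bound on the exponential makes the product O(1/x). *)
Lemma cvg_quadratic_expRN (A B C : R) :
  (A * x ^+ 2 + B * x + C) * expR (- (lambda * x)) @[x --> +oo] --> (0 : R).
Proof.
pose K := (`|A| + `|B| + `|C|) * (6 / lambda ^+ 3).
have K0 : 0 <= K.
  by rewrite /K mulr_ge0// ?addr_ge0// divr_ge0// exprn_ge0// ltW.
have xV0 : x^-1 @[x --> (+oo : set_system R)] --> (0 : R).
  by apply/gtr0_cvgV0; [exact: nbhs_pinfty_gt|exact: cvg_id].
have KV0 : K * x^-1 @[x --> +oo] --> (0 : R).
  by rewrite -[X in _ --> X](mulr0 K); apply: cvgM => //; exact: cvg_cst.
have NKV0 : - (K * x^-1) @[x --> +oo] --> (0 : R).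
  by rewrite -oppr0; exact: cvgN.
apply: squeeze_cvgr NKV0 KV0; near=> x.
have x1 : 1 <= x by near: x; exact: nbhs_pinfty_ge.
have x0 : 0 < x by rewrite (lt_le_trans _ x1).
rewrite -ler_norml normrM (ger0_norm (expR_ge0 _)) expRN.
have e3 : (lambda * x) ^+ 3 / 6 <= expR (lambda * x).
  have := @expR_ge1Dxn R (lambda * x) 2 (mulr_ge0 (ltW lambda_gt0) (ltW x0)).
  rewrite (_ : 3`!%:R = 6 :> R)//; apply: le_trans.
  by rewrite lerDr.
have e0 : 0 < (lambda * x) ^+ 3 / 6 by rewrite divr_gt0// exprn_gt0// mulr_gt0.
have -> : K * x^-1 = ((`|A| + `|B| + `|C|) * x ^+ 2) * ((lambda * x) ^+ 3 / 6)^-1.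
  by rewrite /K; field; rewrite ?gt_eqF.
apply: ler_pM => //.
  rewrite (le_trans (ler_normD _ _))// !mulrDl lerD//.
    rewrite (le_trans (ler_normD _ _))// lerD// normrM.
      by rewrite (ger0_norm (exprn_ge0 _ (ltW x0))).
    by rewrite ler_wpM2l// ger0_norm ?(ltW x0)// expr2 ler_peMl// ltW.
  by rewrite ler_peMr// exprn_ege1.
by rewrite lef_pV2// posrE ?expR_gt0.
Unshelve. all: by end_near. Qed.

(** On the right of [mu] the density is [lambda / 2 * expR (- lambda * (x - mu))],
    so a quadratic polynomial times the density has an antiderivative of the same
    shape.  A single quadratic covers the probability of the tail and both moments
    of the excess over [a]. *)
Lemma integral_laplace_tail (b : bool) (a al be ga : R) :
    mu <= a -> 0 <= al -> 0 <= be -> 0 <= ga ->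
  (\int[leb]_(x in [set` Interval (BSide b a) +oo%O])
     ((al * (x - a) ^+ 2 + be * (x - a) + ga) * laplace_pdf mu lambda x)%:E =
   (2^-1 * expR (- lambda * (a - mu))
      * (2 * al / lambda ^+ 2 + be / lambda + ga))%:E)%E.
Proof.
move=> mua al0 be0 ga0.
pose f x := (al * (x - a) ^+ 2 + be * (x - a) + ga) * laplace_pdf mu lambda x.
have cf : continuous f.
  have cq (x : R) : {for x, continuous (fun t : R => al * (t - a) ^+ 2 + be * (t - a) + ga)}.
    by apply/differentiable_continuous/derivable1_diffP.
  by move=> x; apply: cvgM; [exact: cq|exact: continuous_laplace_pdf].
have -> : (\int[leb]_(x in [set` Interval (BSide b a) +oo%O]) (f x)%:E
         = \int[leb]_(x in `[a, +oo[) (f x)%:E)%E.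
  case: b => //; apply: integral_itv_obnd_cbnd.
  apply/measurable_EFinP/measurable_funTS.
  exact: continuous_measurable_fun cf.
(* [F] has derivative [f] on the right of [mu] exactly when its coefficients
   solve [lambda * B - 2 * al = lambda * be] and [lambda * C - B = lambda * ga]. *)
pose B := be + 2 * al / lambda; pose C := ga + B / lambda.
pose F x := - (2^-1 * (al * (x - a) ^+ 2 + B * (x - a) + C) * expR (- lambda * (x - mu))).
have dF (x : R) : is_derive x 1 F (2^-1 * lambda * (al * (x - a) ^+ 2 + be * (x - a) + ga)
    * expR (- lambda * (x - mu))).
  rewrite /F; apply: is_derive_eq.
  by rewrite /GRing.scale/= /C /B; field; rewrite gt_eqF.
have cF (x : R) : {for x, continuous F}.
  by apply/differentiable_continuous/derivable1_diffP.
rewrite (@ge0_continuous_FTC2y _ f F a 0).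
- rewrite -EFinB; congr EFin; rewrite /F /C /B subrr; field.
  by rewrite gt_eqF.
- move=> x ax; rewrite mulr_ge0 ?laplace_pdf_ge0//.
  by rewrite !addr_ge0// mulr_ge0 ?sqr_ge0// subr_ge0.
- exact: continuous_subspaceT.
- pose c := - 2^-1 * expR (lambda * mu).
  rewrite (_ : F = fun x => (c * al * x ^+ 2 + c * (B - 2 * al * a) * x
      + c * (al * a ^+ 2 - B * a + C)) * expR (- (lambda * x))).
    exact: cvg_quadratic_expRN.
  apply/funext => x; rewrite /F /c.
  rewrite (_ : - lambda * (x - mu) = lambda * mu - lambda * x); last by ring.
  by rewrite expRD; ring.
- by move=> x _; exact: ex_derive.
- by apply: cvg_at_right_filter; exact: cF.
- move=> x; rewrite in_itv/= andbT => ax.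
  rewrite derive1E derive_val /f /laplace_pdf ger0_norm; first by field.
  by rewrite subr_ge0 (le_trans mua)// ltW.
Qed.
End laplace_density.

Section laplace_variable.
Local Open Scope classical_set_scope.
Context d (T : measurableType d) (R : realType) (P : probability T R).
Implicit Types X : {RV P >-> R}.

Lemma ge0_Lfun1 (Y : T -> R) (r : R) : measurable_fun setT Y ->
  (forall w, 0 <= Y w) -> ('E_P[Y])%E = r%:E -> Y \in Lfun P 1.
Proof.
move=> mY Y0 EY; apply/Lfun1_integrable/integrableP; split.
  exact/measurable_EFinP.
under eq_integral => w _ do rewrite /= ger0_norm//.
by move: EY; rewrite unlock => ->; rewrite ltry.
Qed.

Let max0_ge0 (y : R) : 0 <= Num.max y 0.
Proof. by rewrite le_max lexx orbT. Qed.

Lemma max0_Lfun1 (Y : T -> R) (r : R) : measurable_fun setT Y ->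
  ('E_P[(fun w => Num.max (Y w) 0)%R])%E = r%:E ->
  (fun w => Num.max (Y w) 0) \in Lfun P 1.
Proof. by move=> mY; apply: ge0_Lfun1 => //; exact: measurable_maxr. Qed.

Lemma expectation_pos_part X (r m' : R) : (X : T -> R) \in Lfun P 1 ->
  ('E_P[X])%E = r%:E -> ('E_P[(fun w => Num.max (- X w) 0)%R])%E = m'%:E ->
  ('E_P[(fun w => Num.max (X w) 0)%R])%E = (r + m')%:E.
Proof.
move=> LX EX E.
have L := max0_Lfun1 (measurable_funN (@measurable_funP _ _ _ _ setT X)) E.
rewrite EFinD -E -EX -expectationD//; congr expectation.
apply/funext => w /=.
by rewrite /Num.max; case: ltP => h1; case: ltP => h2; lra.
Qed.

Lemma expectation_neg_part X (r m : R) : (X : T -> R) \in Lfun P 1 ->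
  ('E_P[X])%E = r%:E -> ('E_P[(fun w => Num.max (X w) 0)%R])%E = m%:E ->
  ('E_P[(fun w => Num.max (- X w) 0)%R])%E = (m - r)%:E.
Proof.
move=> LX EX E.
have L := max0_Lfun1 (@measurable_funP _ _ _ _ setT X) E.
rewrite EFinB -E -EX -expectationB//; congr expectation.
apply/funext => w /=.
by rewrite /Num.max; case: ltP => h1; case: ltP => h2; lra.
Qed.

Variables (mu lambda : R).
Hypothesis lambda_gt0 : 0 < lambda.

(** Lebesgue measure is invariant under [x |-> - x]. *)
Lemma laplace_distributedN X : laplace_distributed mu lambda X ->
  @laplace_distributed _ T R P (- mu) lambda (- X : {mfun T >-> R}).
Proof.
move=> hX A mA; rewrite /distribution /pushforward.
have mN : measurable [set x : R | A (- x)].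
  rewrite -[X in measurable X]setTI.
  exact: (@oppr_measurable R setT measurableT A mA).
have := hX _ mN; rewrite /distribution /pushforward => ->.
rewrite /laplace_prob.
transitivity (\int[pushforward (@lebesgue_measure R) (-%R : _ -> measurableTypeR R)]_(x in A)
   (laplace_pdf (- mu) lambda x)%:E)%E; last first.
  by apply: eq_measure_integral => B mB _; exact: lebesgue_measureN.
rewrite ge0_integral_pushforward//=.
- by apply: eq_integral => x _; rewrite /laplace_pdf -normrN opprB opprK addrC.
- apply/measurable_EFinP/measurable_funTS; exact: measurable_laplace_pdf.
- by move=> x _; rewrite lee_fin laplace_pdf_ge0.
Qed.

Lemma prob_laplace_tail (b : bool) X (a : R) : laplace_distributed mu lambda X ->
  mu <= a ->
  P (X @^-1` [set` Interval (BSide b a) +oo%O]) =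
  (2^-1 * expR (- lambda * (a - mu)))%:E.
Proof.
move=> hX mua.
have := hX _ (measurable_itv (Interval (BSide b a) +oo%O)).
rewrite /distribution /pushforward => ->.
have := integral_laplace_tail lambda_gt0 b mua (lexx 0) (lexx 0) ler01.
rewrite mulr0 !mul0r !add0r mulr1 => <-; apply: eq_integral => x _.
by rewrite !mul0r !add0r mul1r.
Qed.

Lemma expectation_laplace_tail X (a al be : R) : laplace_distributed mu lambda X ->
  mu <= a -> 0 <= al -> 0 <= be ->
  ('E_P[(fun w => al * Num.max (X w - a) 0 ^+ 2 + be * Num.max (X w - a) 0)%R])%E
   = (2^-1 * expR (- lambda * (a - mu)) * (2 * al / lambda ^+ 2 + be / lambda))%:E.
Proof.
move=> hX mua al0 be0.
pose f (x : R) := al * Num.max (x - a) 0 ^+ 2 + be * Num.max (x - a) 0.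
have f0 x : 0 <= f x by rewrite addr_ge0// mulr_ge0// ?sqr_ge0.
have mm : measurable_fun setT (fun x : R => Num.max (x - a) 0).
  by apply: measurable_maxr => //; exact: measurable_funB.
have mf : measurable_fun setT f.
  apply: measurable_funD; apply: measurable_funM => //.
  exact: measurable_funX.
rewrite unlock.
(* Lebesgue measure lives on the type of reals carrying the generated
   sigma-algebra; [X'] is [X] with values in that type. *)
have mX : measurable_fun setT (X : T -> measurableTypeR R).
  by move=> mT A mA; have := @measurable_funP _ _ _ _ setT X mT A mA.
pose X' : {RV P >-> measurableTypeR R} :=
  HB.pack (X : T -> measurableTypeR R) (isMeasurableFun.Build _ _ _ _ _ mX).
transitivity (\int[distribution P X']_x (f x)%:E)%E.
  by rewrite ge0_integral_distribution//; exact/measurable_EFinP.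
rewrite (@ge0_integral_density _ _ R (@lebesgue_measure R) (distribution P X')
  (fun x => (laplace_pdf mu lambda x)%:E))//.
- have := integral_laplace_tail lambda_gt0 true mua al0 be0 (lexx 0).
  rewrite addr0 => <-; rewrite [RHS]integral_mkcond.
  apply: eq_integral => x _; rewrite patchE/=.
  case: ifPn; rewrite ?inE ?notin_setE /= in_itv/= andbT => h.
    by rewrite addr0 /f max_l// subr_ge0.
  rewrite /f max_r ?expr0n/= ?mulr0 ?addr0 ?mul0e//.
  by rewrite subr_le0 ltW// ltNge; exact/negP.
- by apply/measurable_EFinP; exact: measurable_laplace_pdf.
- by move=> x; rewrite lee_fin laplace_pdf_ge0.
- exact/measurable_EFinP.
Qed.

End laplace_variable.

Section laplace_moments.
Local Open Scope classical_set_scope.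
Context d (T : measurableType d) (R : realType) (P : probability T R).
Variables (mu lambda : R).
Hypothesis lambda_gt0 : 0 < lambda.
Variable X : {RV P >-> R}.
Hypothesis hX : laplace_distributed mu lambda X.

Lemma prob_laplace_tailN (a : R) : a <= mu ->
  P (X @^-1` `]-oo, a]) = (2^-1 * expR (- lambda * (mu - a)))%:E.
Proof.
move=> amu; have Namu : - mu <= - a by rewrite lerN2.
have := prob_laplace_tail lambda_gt0 true (laplace_distributedN lambda_gt0 hX) Namu.
rewrite opprK (addrC (- a)) => <-; congr (P _); apply/seteqP.
by split => w /=; rewrite !in_itv/= andbT lerN2.
Qed.

Lemma expectation_laplace_tailN (a al be : R) :
  a <= mu -> 0 <= al -> 0 <= be ->
  ('E_P[(fun w => al * Num.max (a - X w) 0 ^+ 2 + be * Num.max (a - X w) 0)%R])%E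
   = (2^-1 * expR (- lambda * (mu - a)) * (2 * al / lambda ^+ 2 + be / lambda))%:E.
Proof.
move=> amu al0 be0.
have Namu : - mu <= - a by rewrite lerN2.
have := expectation_laplace_tail lambda_gt0 (laplace_distributedN lambda_gt0 hX)
  Namu al0 be0.
rewrite (addrC (- a)) !opprK => <-.
by congr expectation; apply/funext => w; rewrite /= (addrC a).
Qed.

Lemma expectation_laplace_excess (a : R) : mu <= a ->
  ('E_P[(fun w => Num.max (X w - a) 0)%R])%E
   = (2^-1 * expR (- lambda * (a - mu)) / lambda)%:E.
Proof.
move=> mua; have := expectation_laplace_tail lambda_gt0 hX mua (lexx 0) ler01.
rewrite mulr0 mul0r add0r mul1r => <-; congr expectation.
by apply/funext => w; rewrite mul0r add0r mul1r.
Qed.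

Lemma expectation_laplace_shortfall (a : R) : a <= mu ->
  ('E_P[(fun w => Num.max (a - X w) 0)%R])%E
   = (2^-1 * expR (- lambda * (mu - a)) / lambda)%:E.
Proof.
move=> amu; have := expectation_laplace_tailN amu (lexx 0) ler01.
rewrite mulr0 mul0r add0r mul1r => <-; congr expectation.
by apply/funext => w; rewrite mul0r add0r mul1r.
Qed.

Let mX : measurable_fun setT X := @measurable_funP _ _ _ _ setT X.

(** Split [X - mu] into its positive and negative parts, which have the same
    finite expectation. *)
Lemma laplace_Lfun1_mean : (X : T -> R) \in Lfun P 1 /\ ('E_P[X])%E = mu%:E.
Proof.
have E1 := expectation_laplace_excess (lexx mu).
have E2 := expectation_laplace_shortfall (lexx mu).
have L1 := max0_Lfun1 (measurable_funB mX (measurable_cst mu)) E1.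
have L2 := max0_Lfun1 (measurable_funB (measurable_cst mu) mX) E2.
have XE : (X : T -> R) = (cst mu \+ ((fun w => Num.max (X w - mu) 0)
    \- (fun w => Num.max (mu - X w) 0))).
  apply/funext => w /=.
  by rewrite /Num.max; case: ltP => h1; case: ltP => h2; lra.
have LD : ((fun w => Num.max (X w - mu) 0)
    \- (fun w => Num.max (mu - X w) 0)) \in Lfun P 1 by exact: rpredB.
split; first by rewrite XE rpredD// Lfun_cst.
rewrite XE expectationD ?Lfun_cst// expectationB// expectation_cst.
by rewrite [Y in (_ + (Y - _))%E]E1 [Y in (_ + (_ - Y))%E]E2 -EFinB -EFinD subrr addr0.
Qed.

(** The two halves of [(X - mu) ^+ 2] each contribute [1 / lambda ^+ 2] to the
    variance. *)
Lemma laplace_std_dev : std_dev P X = Num.sqrt 2 / lambda.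
Proof.
have [_ EX] := laplace_Lfun1_mean.
have sqE (Y : T -> R) : (fun w => 1 * Num.max (Y w) 0 ^+ 2 + 0 * Num.max (Y w) 0)
   = (fun w => Num.max (Y w) 0 ^+ 2).
  by apply/funext => w; rewrite mul1r mul0r addr0.
have E1 := expectation_laplace_tail lambda_gt0 hX (lexx mu) ler01 (lexx 0).
have E2 := expectation_laplace_tailN (lexx mu) ler01 (lexx 0).
rewrite sqE in E1; rewrite sqE in E2.
have m1 := measurable_maxr (measurable_funB mX (measurable_cst mu)) (measurable_cst (0 : R)).
have m2 := measurable_maxr (measurable_funB (measurable_cst mu) mX) (measurable_cst (0 : R)).
have L1 := ge0_Lfun1 (measurable_funX 2 m1) (fun=> sqr_ge0 _) E1.
have L2 := ge0_Lfun1 (measurable_funX 2 m2) (fun=> sqr_ge0 _) E2.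
rewrite /std_dev; suff -> : ('V_P[X])%E = (2 / lambda ^+ 2)%:E.
  by rewrite /= sqrtrM// sqrtrV ?sqr_ge0// sqrtr_sqr gtr0_norm.
rewrite /variance unlock EX /=.
transitivity ('E_P[((fun w => Num.max (X w - mu) 0 ^+ 2)
    \+ (fun w => Num.max (mu - X w) 0 ^+ 2))%R])%E.
  congr expectation; apply/funext => w /=; rewrite -(opprB (X w) mu).
  (* The covariance is written with the product of functions. *)
  rewrite /GRing.mul/=.
  by rewrite /Num.max oppr_lt0; case: (ltgtP (X w - mu) 0) => [_|_|->];
    rewrite -?expr2 ?sqrrN ?expr0n/= ?addr0 ?add0r ?mulr0.
rewrite expectationD// [Y in (Y + _)%E]E1 [Y in (_ + Y)%E]E2.
by rewrite -EFinD !subrr !mulr0 expR0; congr EFin; field; rewrite gt_eqF.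
Qed.

End laplace_moments.

(** * Independence *)

Section independence.
Local Open Scope classical_set_scope.
Context d (T : measurableType d) (R : realType) (P : probability T R).

(** By the layer-cake formula, the expectation of [Y * \1_E] is the integral over
    [r >= 0] of the probabilities of [r < Y] on [E], which factor. *)
Lemma ge0_expectation_indep_event (Y : T -> R) (E : set T) :
  measurable_fun setT Y -> (forall w, 0 <= Y w) -> measurable E ->
  (forall r, 0 <= r -> P ([set w | r < Y w] `&` E) = (P [set w | r < Y w]%R * P E)%E) ->
  ('E_P[(fun w => Y w * \1_E w)%R] = P E * 'E_P[Y])%E.
Proof.
move=> mY Y0 mE YE.
have mZ : measurable_fun setT (fun w => Y w * \1_E w).
  by apply: measurable_funM => //; exact: measurable_indic.
have mZ' : isMeasurableFun _ _ _ _ (fun w => Y w * \1_E w) by constructor.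
have mY' : isMeasurableFun _ _ _ _ Y by constructor.
pose Z' : {RV P >-> R} := HB.pack (fun w => Y w * \1_E w) mZ'.
pose Y' : {RV P >-> R} := HB.pack Y mY'.
rewrite (@ge0_expectation_ccdf _ _ _ P Z'); last first.
  by move=> w; rewrite /= mulr_ge0.
rewrite (@ge0_expectation_ccdf _ _ _ P Y')//.
rewrite -ge0_integralZl//=.
- apply: eq_integral => r; rewrite inE/= in_itv/= andbT => r0.
  rewrite /ccdf /distribution /pushforward muleC.
  have -> : Y' @^-1` `]r, +oo[ = [set w | r < Y w].
    by apply/seteqP; split => w /=; rewrite in_itv/= andbT.
  rewrite -YE//; congr (P _); apply/seteqP; split => w /=; rewrite in_itv/= andbT indicE.
    case: (pselect (E w)) => Ew; first by rewrite mem_set//= mulr1.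
    by rewrite memNset//= mulr0 ltNge r0.
  by case=> rY Ew; rewrite mem_set//= mulr1.
- apply: measurable_funTS; exact: ccdf_measurable.
Qed.

Variables (n : nat) (zeta : 'I_n -> {RV P >-> R}).
Hypothesis hindep : mutually_independent zeta.

Lemma measurable_others (i : 'I_n) (D : 'I_n -> set R) :
  (forall j, measurable (D j)) ->
  measurable [set w | forall j, j != i -> D j (zeta j w)].
Proof.
move=> mD.
apply: (@fin_bigcap_measurable _ _ _ [set j | j != i] (fun j => zeta j @^-1` D j)).
  exact: finite_finset.
by move=> j _; exact: measurable_funPTI.
Qed.

(** The product rule over all agents separates [f (zeta i) > r] from the votes of
    the others; the product rule over [[set~ i]] evaluates the latter. *)
Lemma expectation_indep_others (i : 'I_n) (D : 'I_n -> set R) (f : R -> R) :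
  (forall j, measurable (D j)) ->
  measurable_fun setT f -> (forall x, 0 <= f x) ->
  ('E_P[(fun w => f (zeta i w) * \1_[set w | forall j, j != i -> D j (zeta j w)] w)%R]
   = (\prod_(j | j != i) P (zeta j @^-1` D j)) * 'E_P[(f \o zeta i)%R])%E.
Proof.
move=> mD mf f0; have mE := measurable_others i mD.
pose E := [set w | forall j, j != i -> D j (zeta j w)].
have PE : P E = (\prod_(j | j != i) P (zeta j @^-1` D j))%E.
  transitivity (\prod_(j in [set~ i]%SET) P (zeta j @^-1` D j))%E; last first.
    by apply: eq_bigl => j; rewrite !inE.
  rewrite -hindep//; congr (P _); apply/seteqP.
  by split => w h j; have := h j; rewrite !inE.
rewrite -PE; apply: (@ge0_expectation_indep_event (f \o zeta i) E) => //.
- exact: measurableT_comp.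
- by move=> w; exact: f0.
move=> r r0.
have mB : measurable [set x | r < f x].
  by rewrite -[X in measurable X]setTI; exact: measurable_fun_ltr.
pose D' j := if j == i then [set x | r < f x] else D j.
transitivity (P [set w | forall j, j \in [set: 'I_n]%SET -> D' j (zeta j w)]).
  congr (P _); apply/seteqP; split => w /=.
    by move=> [rf Ew] j _; rewrite /D'; case: eqVneq => [->//|/Ew].
  move=> h; split; first by have := h i; rewrite inE /D' eqxx; exact.
  by move=> j ji; have := h j; rewrite inE /D' (negbTE ji); exact.
rewrite hindep; last by move=> j; rewrite /D'; case: ifP.
rewrite (bigD1 i) ?inE//= /D' eqxx PE; congr (_ * _)%E.
by apply: eq_big => [j|j /andP[_ /negbTE ->]//]; rewrite inE.
Qed.

End independence.

(** * Averaging over the agents *)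

(** Swapping [i] and [j] permutes the profiles without changing their size. *)
Lemma sum_subsets_exchangeable (V : nmodType) (n : nat) (c : pred nat)
    (u v : nat -> V) (i j : 'I_n) :
  \sum_(A : {set 'I_n} | c #|A|) (if i \in A then u #|A| else v #|A|) =
  \sum_(A : {set 'I_n} | c #|A|) (if j \in A then u #|A| else v #|A|).
Proof.
pose s (A : {set 'I_n}) := [set tperm i j x | x in A]%SET.
have sK : involutive s.
  move=> A; rewrite /s -imset_comp -[RHS]imset_id.
  by apply: eq_imset => x /=; rewrite tpermK.
have card_s A : #|s A| = #|A| by rewrite card_imset//; exact: perm_inj.
rewrite (reindex_inj (inv_inj sK)); apply: eq_big => A; first by rewrite card_s.
move=> _; rewrite card_s.
by rewrite -{1}(tpermR i j) mem_imset//; exact: perm_inj.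
Qed.

(** As all agents have the same share, [n] times the share of [i] is the sum of
    the shares of all agents, which can be grouped by profile. *)
Lemma sum_subsets_average (R : comPzRingType) (n : nat) (c : pred nat)
    (u v : nat -> R) (i : 'I_n) :
  n%:R * (\sum_(A : {set 'I_n} | c #|A|) (if i \in A then u #|A| else v #|A|)) =
  \sum_(A : {set 'I_n} | c #|A|) (#|A|%:R * u #|A| + (n - #|A|)%:R * v #|A|).
Proof.
transitivity (\sum_(j < n)
    \sum_(A : {set 'I_n} | c #|A|) (if j \in A then u #|A| else v #|A|)).
  rewrite (eq_bigr _ (fun j _ => sum_subsets_exchangeable c u v j i)).
  by rewrite sumr_const card_ord mulr_natl.
rewrite exchange_big/=; apply: eq_bigr => A _.
rewrite (bigID (mem A))/=; congr (_ + _).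
  rewrite (eq_bigr (fun=> u #|A|)) => [|j ->//].
  by rewrite sumr_const mulr_natl.
rewrite (eq_bigr (fun=> v #|A|)) => [|j /negbTE ->//].
rewrite sumr_const mulr_natl; congr (_ *+ _).
by have := cardC (mem A); rewrite card_ord => /(canRL (addKn _)).
Qed.

Section threshold.
Context {R : realType}.
Variables (n : nat) (p q m m' : R).
Hypotheses (p_gt0 : 0 < p) (q_gt0 : 0 < q) (m_ge0 : 0 <= m) (m'_ge0 : 0 <= m').
Hypothesis mqm'p_gt0 : 0 < m * q + m' * p.

(** A given profile with [k] supporters has probability [p ^+ k * q ^+ (n - k)].
    The expected gain on it replaces one factor: [p] by the expectation [m] of the
    positive part for a supporter, [q] by minus the expectation [m'] of the
    negative part for an opponent. *)
Definition winner_gain (k : nat) := m * (p ^+ k.-1 * q ^+ (n - k)).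
Definition loser_gain (k : nat) := - (m' * (p ^+ k * q ^+ (n - k).-1)).
Definition balance_point := m' * p / (m * q + m' * p).

(** Multiplying by [p * q] restores the missing factor of each gain, so that the
    truncated exponents [k.-1] and [(n - k).-1] do no harm at [k = 0] and
    [k = n], where the weights [k] and [n - k] vanish. *)
Lemma total_gainE k : (k <= n)%N ->
  p * q * (k%:R * winner_gain k + (n - k)%:R * loser_gain k) =
  p ^+ k * q ^+ (n - k) * (m * q + m' * p) * (k%:R - balance_point * n%:R).
Proof.
move=> kn; rewrite /winner_gain /loser_gain.
transitivity (p ^+ k * q ^+ (n - k) * (k%:R * m * q - (n - k)%:R * m' * p)).
  rewrite mulrDr mulrBr; congr (_ + _).
    by case: k kn => [|k] kn; rewrite ?mul0r ?mulr0//= exprS; ring.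
  by case: (n - k)%N => [|l]; rewrite ?mul0r ?mulr0 ?oppr0//= exprS; ring.
by rewrite /balance_point natrB//; field; rewrite gt_eqF.
Qed.

Lemma total_gain_ge0 k : (k <= n)%N -> balance_point * n%:R < k%:R ->
  0 <= k%:R * winner_gain k + (n - k)%:R * loser_gain k.
Proof.
move=> kn h; rewrite -(pmulr_rge0 _ (mulr_gt0 p_gt0 q_gt0)) total_gainE//.
by rewrite !mulr_ge0 ?exprn_ge0 ?subr_ge0 ?ltW.
Qed.

Lemma total_gain_le0 k : (k <= n)%N -> k%:R <= balance_point * n%:R ->
  k%:R * winner_gain k + (n - k)%:R * loser_gain k <= 0.
Proof.
move=> kn h; rewrite -(pmulr_rle0 _ (mulr_gt0 p_gt0 q_gt0)) total_gainE//.
by rewrite mulr_ge0_le0 ?subr_le0// !mulr_ge0 ?exprn_ge0 ?ltW.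
Qed.

Lemma balance_point_itv : 0 <= balance_point <= 1.
Proof.
rewrite /balance_point divr_ge0 ?(ltW mqm'p_gt0) ?mulr_ge0 ?(ltW p_gt0)//=.
by rewrite ler_pdivrMr// mul1r lerDr mulr_ge0// ltW.
Qed.

(** After averaging, the threshold [balance_point] selects every profile of
    positive total gain and none of negative total gain. *)
Lemma balance_point_max (i : 'I_n) (beta : R) :
  \sum_(A : {set 'I_n} | beta * n%:R < #|A|%:R)
     (if i \in A then winner_gain #|A| else loser_gain #|A|) <=
  \sum_(A : {set 'I_n} | balance_point * n%:R < #|A|%:R)
     (if i \in A then winner_gain #|A| else loser_gain #|A|).
Proof.
have n0 : 0 < n%:R :> R by rewrite ltr0n (leq_ltn_trans _ (ltn_ord i)).
rewrite -(ler_pM2l n0).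
rewrite (sum_subsets_average (fun k => beta * n%:R < k%:R)).
rewrite (sum_subsets_average (fun k => balance_point * n%:R < k%:R)).
rewrite big_mkcond [leRHS]big_mkcond/=; apply: ler_sum => A _.
have An : (#|A| <= n)%N by rewrite -[leqRHS](card_ord n) max_card.
case: ifPn => _; case: ifPn => //; last exact: total_gain_ge0.
by rewrite -leNgt; exact: total_gain_le0.
Qed.

End threshold.

(** * The optimal threshold of a society of egoists *)

Section egoists.
Local Open Scope classical_set_scope.
Context d (T : measurableType d) (R : realType) (P : probability T R).
Variables (n : nat) (zeta : 'I_n -> {RV P >-> R}).
Hypothesis hindep : mutually_independent zeta.
Variables (p q m m' : R).
Hypotheses (p_gt0 : 0 < p) (q_gt0 : 0 < q) (m_ge0 : 0 <= m) (m'_ge0 : 0 <= m').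
Hypothesis mqm'p_gt0 : 0 < m * q + m' * p.
Hypothesis prob_pos : forall i, P (zeta i @^-1` `]0, +oo[) = p%:E.
Hypothesis prob_npos : forall i, P (zeta i @^-1` `]-oo, 0]) = q%:E.
Hypothesis pos_part : forall i, ('E_P[(fun w => Num.max (zeta i w) 0)%R] = m%:E)%E.
Hypothesis neg_part : forall i, ('E_P[(fun w => Num.max (- zeta i w) 0)%R] = m'%:E)%E.

Local Notation voters w := [set k | 0 < zeta k w]%SET.

Let vote_set (A : {set 'I_n}) (j : 'I_n) : set R :=
  if j \in A then `]0, +oo[%classic else `]-oo, 0]%classic.

Let measurable_vote_set A j : measurable (vote_set A j).
Proof. by rewrite /vote_set; case: ifP. Qed.

Let others (A : {set 'I_n}) (i : 'I_n) : set T :=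
  [set w | forall j, j != i -> vote_set A j (zeta j w)].

Let vote_setP A j w : vote_set A j (zeta j w) <-> (j \in voters w) = (j \in A).
Proof.
rewrite /vote_set inE; case: (j \in A); rewrite /= in_itv/= ?andbT//.
by rewrite leNgt; split => [/negbTE//|->].
Qed.

Lemma prob_others A i :
  (\prod_(j | j != i) P (zeta j @^-1` vote_set A j))%E =
  (p ^+ #|A :\ i|%SET * q ^+ #|~: A :\ i|%SET)%:E.
Proof.
rewrite (eq_bigr (fun j => (if j \in A then p else q)%:E)); last first.
  by move=> j _; rewrite /vote_set; case: ifP => _; [exact: prob_pos|exact: prob_npos].
rewrite prodEFin; congr EFin.
rewrite (bigID (mem A))/=; congr (_ * _).
  rewrite (eq_bigr (fun=> p)) => [|j /andP[_ ->]//].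
  by rewrite prodr_const; congr (_ ^+ _); apply: eq_card => j; rewrite !inE.
rewrite (eq_bigr (fun=> q)) => [|j /andP[_ /negbTE ->]//].
by rewrite prodr_const; congr (_ ^+ _); apply: eq_card => j; rewrite !inE.
Qed.

(** For a supporter of [A], the increment times the indicator of the profile [A]
    is the positive part of the increment times the indicator that the others
    vote as in [A]; for an opponent it is minus the negative part times that
    indicator.  Each product is one of independent factors. *)
Lemma expectation_profile A i :
  ('E_P[(fun w => zeta i w * (voters w == A)%:R)%R] =
   (if i \in A then winner_gain n p q m #|A| else loser_gain n p q m' #|A|)%:E)%E
  /\ (fun w => zeta i w * (voters w == A)%:R) \in Lfun P 1.
Proof.
have votersE w : voters w = A <-> vote_set A i (zeta i w) /\ others A i w.
  split=> [wA|[iA oA]].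
    by split; [|move=> j _]; apply/vote_setP; rewrite wA.
  apply/setP => j; have [->|ji] := eqVneq j i; first exact/vote_setP.
  by apply/vote_setP; exact: oA.
pose f (x : R) : R := if i \in A then Num.max x 0 else Num.max (- x) 0.
pose s : R := if i \in A then 1 else -1.
have f0 x : 0 <= f x by rewrite /f; case: ifP; rewrite le_max lexx orbT.
have mf : measurable_fun setT f.
  rewrite /f; case: (i \in A); first exact: measurable_maxr.
  by apply: measurable_maxr => //; exact: measurable_funN.
have profileE : (fun w => zeta i w * (voters w == A)%:R) =
    (s \o* (fun w => f (zeta i w) * \1_(others A i) w)).
  apply/funext => w /=.
  have [/votersE[iA oA]|/eqP nA] := eqVneq (voters w) A.
    rewrite indicE mem_set// !mulr1 /f /s.
    move: iA; rewrite /vote_set; case: ifP => _; rewrite /= in_itv/= ?andbT => h.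
      by rewrite mulr1 max_l// ltW.
    by rewrite max_l ?oppr_ge0// mulrN1 opprK.
  rewrite mulr0 indicE.
  have [oA|noA] := pselect (others A i w); last first.
    by rewrite memNset// mulr0 mul0r.
  rewrite mem_set// mulr1.
  have : ~ vote_set A i (zeta i w) by move=> iA; apply: nA; exact/votersE.
  rewrite /vote_set /f; case: ifP => _; rewrite /= in_itv/= ?andbT => /negP h.
    by rewrite max_r ?mul0r// leNgt.
  by rewrite max_r ?mul0r// oppr_le0 ltW// ltNge.
have Ef := expectation_indep_others hindep i (measurable_vote_set A) mf f0.
have Efi : ('E_P[(f \o zeta i)%R] = (if i \in A then m else m')%:E)%E.
  rewrite /f; case: (i \in A); first exact: pos_part.
  exact: neg_part.
rewrite Efi prob_others -EFinM in Ef.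
have Lf : (fun w => f (zeta i w) * \1_(others A i) w) \in Lfun P 1.
  apply: ge0_Lfun1 Ef; last by move=> w; rewrite mulr_ge0.
  apply: measurable_funM; first exact: measurableT_comp.
  by apply: measurable_indic; exact: measurable_others.
split; last by rewrite profileE Lfun_scale.
rewrite profileE expectationZl// [X in (_ * X)%E]Ef -EFinM; congr EFin.
rewrite /s /winner_gain /loser_gain.
have -> : (n - #|A|)%N = #|~: A|%SET.
  by have := cardsC A; rewrite card_ord => /(canRL (addKn _)).
have := cardsD1 i A; have := cardsD1 i (~: A)%SET; rewrite finset.in_setC.
by case: (i \in A) => /= -> ->; rewrite add0n add1n/= ?mul1r ?mulN1r mulrC.
Qed.

(** Accepted outcomes are partitioned by their profile, and acceptance depends on
    the profile only. *)
Lemma expectation_actual_increment (beta : R) i :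
  ('E_P[actual_increment zeta beta i] =
   (\sum_(A : {set 'I_n} | (beta * n%:R < #|A|%:R)%R)
      if i \in A then winner_gain n p q m #|A| else loser_gain n p q m' #|A|)%:E)%E.
Proof.
pose g (A : {set 'I_n}) w := zeta i w * (voters w == A)%:R.
pose s := seq.filter (fun A : {set 'I_n} => beta * n%:R < #|A|%:R) (index_enum _).
have -> : actual_increment zeta beta i = \sum_(h <- map g s) h.
  apply/funext => w; rewrite big_map big_filter/= fct_sumE.
  rewrite /actual_increment /accepted /votes_for /g -mulr_sumr; congr (_ * _).
  rewrite big_mkcond (bigD1 (voters w))//= eqxx big1 ?addr0; first by case: ifP.
  by move=> A /negbTE; rewrite eq_sym => ->; case: ifP.
rewrite expectation_sum; last first.
  by move=> h /mapP[A _ ->]; have [] := expectation_profile A i.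
rewrite big_map big_filter/= -sumEFin.
by apply: eq_bigr => A _; have [] := expectation_profile A i.
Qed.

Lemma balance_point_optimal : (0 < n)%N ->
  optimal_threshold zeta (balance_point p q m m').
Proof.
move=> n0; have /andP[b0 b1] := balance_point_itv p_gt0 q_gt0 m_ge0 m'_ge0 mqm'p_gt0.
split=> [|beta _ i].
  by rewrite /admissible_threshold b1 andbT (le_trans _ b0)// oppr_le0 invr_ge0.
by rewrite !expectation_actual_increment lee_fin balance_point_max.
Qed.
End egoists.

(** * The Laplace threshold *)

Section threshold_formula.
Context {R : realType}.
Variables (mu lambda : R).
Hypothesis lambda_gt0 : 0 < lambda.

Let rate_scaled_normE : Num.sqrt 2 * `|mu / (Num.sqrt 2 / lambda)| = lambda * `|mu|.
Proof.
have s2 : 0 < Num.sqrt 2 :> R by rewrite sqrtr_gt0.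
rewrite !normrM !normfV normrM normfV (gtr0_norm lambda_gt0) (gtr0_norm s2).
by field; rewrite !gt_eqF.
Qed.

Let sg_scaledE : Num.sg (mu / (Num.sqrt 2 / lambda)) = Num.sg mu.
Proof.
have sd0 : 0 < Num.sqrt 2 / lambda by rewrite divr_gt0// sqrtr_gt0.
by rewrite sgrM (gtr0_sg (_ : 0 < _^-1)) ?mulr1// invr_gt0.
Qed.

Lemma laplace_threshold_ge0 : 0 <= mu ->
  laplace_threshold (mu / (Num.sqrt 2 / lambda)) =
  (1 - 2^-1 * expR (- lambda * mu)) / (1 + lambda * mu).
Proof.
move=> mu0; rewrite /laplace_threshold rate_scaled_normE sg_scaledE.
rewrite ger0_norm// -mulNr.
have [mu_gt0|mu_le0|<-] := ltgtP 0 mu.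
- rewrite gtr0_sg//; field.
  by rewrite gt_eqF// ltr_wpDr// mulr_ge0// ltW.
- by rewrite leNgt mu_le0 in mu0.
(* At [mu = 0] the sign vanishes, but so does the fraction it multiplies. *)
- by rewrite sgr0 !mulr0 expR0; field.
Qed.

Lemma laplace_threshold_lt0 : mu < 0 ->
  laplace_threshold (mu / (Num.sqrt 2 / lambda)) =
  (2^-1 * expR (lambda * mu) - lambda * mu) / (1 - lambda * mu).
Proof.
move=> mu0; rewrite /laplace_threshold rate_scaled_normE sg_scaledE.
rewrite ltr0_norm// ltr0_sg// mulrN opprK; field.
by rewrite gt_eqF// subr_gt0 (lt_trans _ ltr01)// pmulr_rlt0.
Qed.
End threshold_formula.

Section laplace_society.
Local Open Scope classical_set_scope.
Context d (T : measurableType d) (R : realType) (P : probability T R).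
Variables (n : nat) (n_gt0 : (0 < n)%N) (mu lambda : R).
Hypothesis lambda_gt0 : 0 < lambda.
Variable zeta : 'I_n -> {RV P >-> R}.
Hypothesis hindep : mutually_independent zeta.
Hypothesis hlaplace : forall i, laplace_distributed mu lambda (zeta i).

Let LX i := (laplace_Lfun1_mean lambda_gt0 (hlaplace i)).1.
Let EX i := (laplace_Lfun1_mean lambda_gt0 (hlaplace i)).2.

(** Zero is in the lower tail, which gives [q] and the negative part. *)
Lemma laplace_optimal_ge0 : 0 <= mu ->
  optimal_threshold zeta (laplace_threshold (mu / (Num.sqrt 2 / lambda))).
Proof.
move=> mu_ge0.
have lmu_ge0 : 0 <= lambda * mu by rewrite mulr_ge0// ltW.
pose q := 2^-1 * expR (- lambda * mu).
have q_gt0 : 0 < q by rewrite mulr_gt0// expR_gt0.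
have q_lt1 : q < 1.
  have : expR (- lambda * mu) <= 1 by rewrite -expR0 ler_expR mulNr oppr_le0.
  by rewrite /q; lra.
have prob_npos i : P (zeta i @^-1` `]-oo, 0]) = q%:E.
  by rewrite (prob_laplace_tailN lambda_gt0 (hlaplace i) mu_ge0) subr0.
have prob_pos i : P (zeta i @^-1` `]0, +oo[) = (1 - q)%:E.
  by rewrite EFinB -(prob_npos i); exact: (ccdf_1_cdf (zeta i) 0).
have neg_part i : ('E_P[(fun w => Num.max (- zeta i w) 0)%R] = (q / lambda)%:E)%E.
  have := expectation_laplace_shortfall lambda_gt0 (hlaplace i) mu_ge0.
  rewrite subr0 => <-; congr expectation.
  by apply/funext => w; rewrite sub0r.
have pos_part i := expectation_pos_part (LX i) (EX i) (neg_part i).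
have qV_gt0 : 0 < q / lambda by rewrite divr_gt0.
have S0 : 0 < (mu + q / lambda) * q + q / lambda * (1 - q).
  apply: ltr_wpDl; last by rewrite mulr_gt0// subr_gt0.
  by rewrite mulr_ge0 ?addr_ge0// ltW.
rewrite laplace_threshold_ge0// -/q.
have -> : (1 - q) / (1 + lambda * mu) =
    balance_point (1 - q) q (mu + q / lambda) (q / lambda).
  rewrite /balance_point; field.
  have -> : (mu * lambda + q) * q + q * (1 - q) = q * (1 + lambda * mu) by ring.
  have S1 : 0 < 1 + lambda * mu by rewrite ltr_wpDr.
  by rewrite !gt_eqF// mulr_gt0.
by apply: balance_point_optimal => //; rewrite ?subr_gt0 ?addr_ge0// ltW.
Qed.

(** Zero is in the upper tail, which gives [p] and the positive part. *)
Lemma laplace_optimal_lt0 : mu < 0 ->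
  optimal_threshold zeta (laplace_threshold (mu / (Num.sqrt 2 / lambda))).
Proof.
move=> mu_lt0.
have lmu_lt0 : lambda * mu < 0 by rewrite pmulr_rlt0.
pose p := 2^-1 * expR (lambda * mu).
have p_gt0 : 0 < p by rewrite mulr_gt0// expR_gt0.
have p_lt1 : p < 1.
  have : expR (lambda * mu) <= 1 by rewrite -expR0 ler_expR ltW.
  by rewrite /p; lra.
have prob_pos i : P (zeta i @^-1` `]0, +oo[) = p%:E.
  by rewrite (prob_laplace_tail lambda_gt0 false (hlaplace i) (ltW mu_lt0)) sub0r mulrNN.
have prob_npos i : P (zeta i @^-1` `]-oo, 0]) = (1 - p)%:E.
  by rewrite EFinB -(prob_pos i); exact: (cdf_1_ccdf (zeta i) 0).
have pos_part i : ('E_P[(fun w => Num.max (zeta i w) 0)%R] = (p / lambda)%:E)%E.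
  have := expectation_laplace_excess lambda_gt0 (hlaplace i) (ltW mu_lt0).
  rewrite sub0r mulrNN => <-; congr expectation.
  by apply/funext => w; rewrite subr0.
have neg_part i := expectation_neg_part (LX i) (EX i) (pos_part i).
have m'_gt0 : 0 < p / lambda - mu.
  by rewrite subr_gt0 (lt_le_trans mu_lt0)// divr_ge0 ?ltW.
have S0 : 0 < p / lambda * (1 - p) + (p / lambda - mu) * p.
  by apply: addr_gt0; apply: mulr_gt0 => //; rewrite ?subr_gt0// divr_gt0.
rewrite laplace_threshold_lt0// -/p.
have -> : (p - lambda * mu) / (1 - lambda * mu) =
    balance_point p (1 - p) (p / lambda) (p / lambda - mu).
  rewrite /balance_point; field.
  have -> : p * (1 - p) + (p + - mu * lambda) * p = p * (1 - lambda * mu) by ring.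
  have S1 : 0 < 1 - lambda * mu by rewrite subr_gt0 (lt_trans lmu_lt0).
  by rewrite !gt_eqF// mulr_gt0.
by apply: balance_point_optimal => //; rewrite ?subr_gt0 ?divr_ge0// ltW.
Qed.

End laplace_society.

Theorem corollary6 (d : measure_display) (T : measurableType d) (R : realType)
    (P : probability T R) (n : nat) (hn : (0 < n)%N)
    (mu lambda : R) (hlambda : 0 < lambda)
    (zeta : 'I_n -> {RV P >-> R})
    (hindep : mutually_independent zeta)
    (hlaplace : forall i, laplace_distributed mu lambda (zeta i))
    (sigma : R) (hsigma : forall i, sigma = std_dev P (zeta i)) :
  optimal_threshold zeta (laplace_threshold (mu / sigma)).
Proof.
rewrite (hsigma (Ordinal hn)) (laplace_std_dev hlambda (hlaplace _)).
have [mu_ge0|mu_lt0] := leP 0 mu.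
- exact: laplace_optimal_ge0.
- exact: laplace_optimal_lt0.
Qed.
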